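(* Let $(p_{ij}\colon(X_j,\nu_j)\to(X_i,\nu_i))_{i\sqsubseteq j\in I}$ be a projective system of valued spaces, and let $X,(p_i)_{i\in I}$ be a projective limit, in the category of topological spaces, of the underlying projective system $(p_{ij}\colon X_j\to X_i)_{i\sqsubseteq j\in I}$. If $I$ has a countable cofinal subset, and if every $X_i$ is locally compact and sober, then there is a unique continuous valuation $\nu$ on $X$ such that $\nu_i=p_i[\nu]$ for every $i\in I$. Moreover, $\nu$ is tight.
   Context: For a topological space $X$, $\mathcal O X$ is its lattice of open subsets, and $\overline{\mathbb R}_+=[0,\infty]$. A valuation on $X$ is a map $\nu\colon\mathcal O X\to\overline{\mathbb R}_+$ with $\nu(\emptyset)=0$, $U\subseteq V\Rightarrow\nu(U)\le\nu(V)$, and $\nu(U\cup V)+\nu(U\cap V)=\nu(U)+\nu(V)$. It is continuous if it preserves suprema of directed families of open sets. For $f\colon X\to Y$ continuous, $f[\nu](V)=\nu(f^{-1}(V))$ for $V\in\mathcal O Y$. A projective system of valued spaces $(p_{ij}\colon(X_j,\nu_j)\to(X_i,\nu_i))_{i\sqsubseteq j\in I}$ consists of a directed preordered set $(I,\sqsubseteq)$, topological spaces $X_i$ with continuous valuations $\nu_i$ ($i\in I$), and continuous maps $p_{ij}\colon X_j\to X_i$ for $i\sqsubseteq j$, with $p_{ii}=\mathrm{id}$, $p_{ij}\circ p_{jk}=p_{ik}$ for $i\sqsubseteq j\sqsubseteq k$, and $p_{ij}[\nu_j]=\nu_i$ for $i\sqsubseteq j$. A projective limit of the underlying system of spaces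 is its limit in the category of topological spaces; up to isomorphism it is the subspace $\{\vec x\in\prod_i X_i\mid x_i=p_{ij}(x_j)\ \forall i\sqsubseteq j\}$ of the product, with $p_i(\vec x)=x_i$. A set is saturated iff it is an intersection of open sets. Compactness does not include Hausdorffness. A space is locally compact if every open subset $U$ is the directed union of the interiors of the compact saturated subsets of $U$. A space is sober if it is $T_0$ and every irreducible closed subset is the closure of a point. For a map $\nu\colon\mathcal O X\to\overline{\mathbb R}_+$ and $Q\subseteq X$ compact saturated, $\nu^\bullet(Q)=\inf\{\nu(U)\mid U \text{ open},\,Q\subseteq U\}$. For $r,s\in\overline{\mathbb R}_+$, $r\ll s$ iff $r=0$ or $r<s$. The map $\nu$ is tight if for every open $U$ and every $r\ll\nu(U)$ there is a compact saturated $Q\subseteq U$ with $r\le\nu^\bullet(Q)$. *)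

(* Defs.v *)
From HB Require Import structures.
From mathcomp Require Import all_boot all_order all_algebra.
From mathcomp Require Import all_classical all_reals all_analysis.

Set Implicit Arguments.
Unset Strict Implicit.
Unset Printing Implicit Defensive.

Import Order.TTheory GRing.Theory Num.Theory.

Local Open Scope classical_set_scope.
Local Open Scope ereal_scope.

(* Directed sets are nonempty by convention. *)
Definition directed {T : Type} (le : T -> T -> Prop) (D : set T) : Prop :=
  D !=set0 /\
  forall x y, D x -> D y -> exists z, [/\ D z, le x z & le y z].

Section Spaces.
Context {X : topologicalType}.

Definition saturated (A : set X) : Prop :=
  exists2 F : set (set X), F `<=` open & A = \bigcap_(U in F) U.

Definition compact_saturated (Q : set X) : Prop := compact Q /\ saturated Q.

Definition irreducible (C : set X) : Prop :=
  C !=set0 /\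
  forall A B : set X, closed A -> closed B ->
    C `<=` A `|` B -> C `<=` A \/ C `<=` B.

End Spaces.

Definition sober_space (X : topologicalType) : Prop :=
  kolmogorov_space X /\
  forall C : set X, closed C -> irreducible C ->
    exists x : X, C = closure [set x].

(* Not the library's [locally_compact [set: X]], which asks for a closed
   compact neighbourhood of every point: compact saturated sets need not be
   closed in a non-Hausdorff space. *)
Definition locally_compact_space (X : topologicalType) : Prop :=
  forall U : set X, open U ->
    let interiors :=
      [set Q° | Q in [set Q : set X | compact_saturated Q /\ Q `<=` U]] in
    directed subset interiors /\ U = \bigcup_(V in interiors) V.

(* A map from the open subsets of X to [0, +oo] is represented by a function on
   all subsets of X, of which only the values at open sets are ever
   considered; accordingly, two such maps are equal when they agree at every
   open set ([eq_on_opens]). *)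
Section Valuations.
Context {R : realType} {X : topologicalType}.
Implicit Types mu nu : set X -> \bar R.

Definition eq_on_opens mu nu : Prop :=
  forall U : set X, open U -> mu U = nu U.

Definition valuation nu : Prop :=
  [/\ forall U, open U -> 0 <= nu U,
      nu set0 = 0,
      forall U V, open U -> open V -> U `<=` V -> nu U <= nu V &
      forall U V, open U -> open V ->
        nu (U `|` V) + nu (U `&` V) = nu U + nu V].

Definition continuous_valuation nu : Prop :=
  valuation nu /\
  forall D : set (set X), D `<=` open -> directed subset D ->
    nu (\bigcup_(U in D) U) = ereal_sup [set nu U | U in D].

Definition bullet nu (Q : set X) : \bar R :=
  ereal_inf [set nu U | U in [set U : set X | open U /\ Q `<=` U]].

Definition way_below (r s : \bar R) : Prop := r = 0 \/ r < s.

Definition tight nu : Prop :=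
  forall U : set X, open U ->
  forall r : \bar R, 0 <= r -> way_below r (nu U) ->
    exists Q : set X, [/\ compact_saturated Q, Q `<=` U & r <= bullet nu Q].

End Valuations.

Definition image_valuation {R : realType} {X Y : topologicalType}
    (f : X -> Y) (nu : set X -> \bar R) : set Y -> \bar R :=
  fun V => nu (f @^-1` V).

Section ProjectiveSystems.
Context {d : Order.disp_t} {I : preorderType d} {X : I -> topologicalType}.
Variable p : forall i j : I, (i <= j)%O -> X j -> X i.

Definition projective_system : Prop :=
  [/\ directed (fun i j : I => (i <= j)%O) [set: I],
      forall (i j : I) (ij : (i <= j)%O), continuous (p ij),
      forall (i : I) (ii : (i <= i)%O), p ii = id &
      forall (i j k : I) (ij : (i <= j)%O) (jk : (j <= k)%O) (ik : (i <= k)%O),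
        p ij \o p jk = p ik].

Definition valued_projective_system {R : realType}
    (nu : forall i : I, set (X i) -> \bar R) : Prop :=
  [/\ projective_system,
      forall i : I, continuous_valuation (nu i) &
      forall (i j : I) (ij : (i <= j)%O),
        eq_on_opens (image_valuation (p ij) (nu j)) (nu i)].

Definition cone (Y : topologicalType) (q : forall i : I, Y -> X i) : Prop :=
  (forall i : I, continuous (q i)) /\
  forall (i j : I) (ij : (i <= j)%O), p ij \o q j = q i.

Definition projective_limit (L : topologicalType)
    (q : forall i : I, L -> X i) : Prop :=
  cone q /\
  forall (Y : topologicalType) (r : forall i : I, Y -> X i), cone r ->
    exists! h : Y -> L, continuous h /\ forall i : I, q i \o h = r i.

End ProjectiveSystems.

Definition has_countable_cofinal {d : Order.disp_t} (I : preorderType d) :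
    Prop :=
  exists2 C : set I, countable C &
    forall i : I, exists2 j : I, C j & (i <= j)%O.

(* Main.v *)
(* For U open in the limit, let U_i be the largest open subset of X_i whose
   preimage is included in U.  Since U is the directed union of the preimages
   of the U_i, continuity forces nu U = sup_i nu_i(U_i).  Conversely, this
   formula defines a continuous valuation as soon as nu_k(W) <= sup_i nu_i(V_i)
   whenever the preimages of an increasing family of open sets V_i cover the
   preimage of W.  To see this for r < nu_k(W), choose along a cofinal sequence
   starting above k compact saturated sets Q_n with nu_n(int Q_n) > r, Q_0
   inside the preimage of W and Q_(n+1) inside the preimage of int Q_n.  If no
   Q_n were included in V_n, Steenrod's theorem for compact sober spaces would
   give a point of the limit lying in every Q_n but outside every V_i.  The
   intersection of the preimages of the Q_n also witnesses tightness. *)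
From HB Require Import structures.
Require Import Defs.
From mathcomp Require Import all_boot all_order all_algebra.
From mathcomp Require Import all_classical all_reals all_analysis.

Set Implicit Arguments.
Unset Strict Implicit.
Unset Printing Implicit Defensive.

Import Order.TTheory GRing.Theory Num.Theory.

Local Open Scope classical_set_scope.
Local Open Scope ereal_scope.

(** * Compact and saturated sets *)

Section Compactness.
Context {X : topologicalType}.
Implicit Types (Q U V : set X) (D : set (set X)).

(** If no [U] in [D] contained [Q], the differences [Q] minus [U] would form a base of a proper
    filter. It would have a cluster point in [Q], which lies in some [U] although [U] misses a
    member of the filter. *)
Lemma compact_directed_cover Q D : compact Q -> D `<=` open ->
  directed subset D -> Q `<=` \bigcup_(U in D) U -> exists2 U, D U & Q `<=` U.
Proof.
move=> cQ Dop [[U0 DU0] Ddir] QD; apply: contrapT => noU.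
pose F := filter_from D (fun U => Q `\` U).
have FF : ProperFilter F.
  apply: filter_from_proper.
    apply: filter_from_filter; first by exists U0.
    move=> U V DU DV; have [W [DW UW VW]] := Ddir U V DU DV.
    by exists W => // x [Qx nWx]; split; split=> // ?; apply: nWx; auto.
  move=> U DU; apply: contrapT => /nonemptyPn Q0; apply: noU; exists U => //.
  by rewrite -setD_eq0.
have FQ : F Q by exists U0 => // x [].
have [x [Qx Fx]] := cQ F FF FQ.
have [U DU Ux] := QD x Qx.
have FU : F (Q `\` U) by exists U.
have [y [[_ nUy] Uy]] := Fx _ _ FU (open_nbhs_nbhs (conj (Dop _ DU) Ux)).
exact: nUy.
Qed.

(** For a filter without cluster point in [Q], the open sets whose complement belongs to the filter
    form a directed cover of [Q]. A member containing [Q] would make the filter improper. *)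
Lemma directed_cover_compact Q :
  (forall D, D `<=` open -> directed subset D -> Q `<=` \bigcup_(U in D) U ->
    exists2 U, D U & Q `<=` U) -> compact Q.
Proof.
move=> H F FF FQ; apply: contrapT => /nonemptyPn noX.
have [||x Qx|U [Uop FU] QU] := H [set U | open U /\ F (~` U)].
- by move=> U [].
- split.
    by exists set0; split; [exact: open0|rewrite setC0; exact: filterT].
  move=> U V [Uop FU] [Vop FV]; exists (U `|` V); split.
  + by split; [exact: openU|rewrite setCU; exact: filterI].
  + exact: subsetUl.
  + exact: subsetUr.
- have : ~ cluster F x by move=> Fx; have : set0 x by rewrite -noX.
  move=> /existsNP[A] /existsNP[B] /not_implyP[FA] /not_implyP[nB].
  move=> /nonemptyPn AB; move: nB; rewrite nbhsE => -[U [Uop Ux] UB].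
  exists U => //; split=> //; apply: filterS FA => y Ay Uy.
  by have : set0 y by rewrite -AB; split=> //; exact: UB.
have : F set0.
  by apply: filterS (filterI FQ FU) => y [Qy]; apply; exact: QU.
exact: filter_not_empty.
Qed.

(** [closure [set x] y] says that [y] is below [x] in the specialization preorder, and saturated
    sets are upper sets. *)
Lemma saturated_specialization Q (x y : X) :
  saturated Q -> Q y -> closure [set x] y -> Q x.
Proof.
move=> [F Fop ->] Fy yx U FU.
have [z [-> //]] := yx U (open_nbhs_nbhs (conj (Fop _ FU) (Fy _ FU))).
Qed.

Lemma saturated_bigcap (T : Type) (A : T -> set X) :
  (forall t, saturated (A t)) -> saturated (\bigcap_t A t).
Proof.
move=> satA; exists [set U | open U /\ \bigcap_t A t `<=` U].
  by move=> U [].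
apply/seteqP; split=> [x Ax U [_]|x Ux t _]; first exact.
have [F Fop AF] := satA t; rewrite AF => U FU; apply: Ux.
split; first exact: Fop.
by move=> y /(_ t I); rewrite AF; exact.
Qed.

End Compactness.

Lemma saturated_preimage (X Y : topologicalType) (f : X -> Y) (A : set Y) :
  continuous f -> saturated A -> saturated (f @^-1` A).
Proof.
move=> /continuousP fc [F Fop ->]; exists [set f @^-1` U | U in F].
  by move=> _ [U FU <-]; apply/fc/Fop.
apply/seteqP; split=> x Ax; first by move=> _ [U FU <-]; exact: Ax.
by move=> U FU; apply: (Ax (f @^-1` U)); exists U.
Qed.

(** * Steenrod's theorem *)

Section OpenSystems.
Context {d : Order.disp_t} {I : preorderType d} {X : I -> topologicalType}.
Variable p : forall i j : I, (i <= j)%O -> X j -> X i.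

Definition thread (x : forall i, X i) : Prop :=
  forall (i j : I) (ij : (i <= j)%O), p ij (x j) = x i.

(** Equivalently, the complements of the [V i] are closed sets mapped into one another by the
    [p ij]. *)
Definition open_system (V : forall i, set (X i)) : Prop :=
  (forall i, open (V i)) /\
  forall (i j : I) (ij : (i <= j)%O), p ij @^-1` V i `<=` V j.

Hypothesis psys : projective_system p.
Hypothesis sober : forall i, sober_space (X i).

Variables Q V : forall i, set (X i).
Arguments Q : clear implicits.
Arguments V : clear implicits.
Hypothesis Qcs : forall i, compact_saturated (Q i).
Hypothesis Qp : forall (i j : I) (ij : (i <= j)%O), Q j `<=` p ij @^-1` Q i.
Hypothesis Vsys : open_system V.

Lemma psys_id i (ii : (i <= i)%O) x : p ii x = x.
Proof. by have [_ _ pid _] := psys; rewrite pid. Qed.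

Lemma psys_comp i j k (ij : (i <= j)%O) (jk : (j <= k)%O) (ik : (i <= k)%O) x :
  p ij (p jk x) = p ik x.
Proof. by have [_ _ _ pcomp] := psys; rewrite -(pcomp _ _ _ ij jk). Qed.

Lemma psys_open i j (ij : (i <= j)%O) (U : set (X i)) :
  open U -> open (p ij @^-1` U).
Proof. by have [_ pcont _ _] := psys; exact: (continuousP _).1. Qed.

Lemma psys_ub (i j : I) : exists2 k : I, (i <= k)%O & (j <= k)%O.
Proof.
have [[_ dirI] _ _ _] := psys.
by have [//|//|k [_ ik jk]] := dirI i j; exists k.
Qed.

(** With [V] built into the condition, instead of asking that [A] contain [V], the empty family
    qualifies; it is the union of the empty chain in Zorn's lemma. *)
Definition avoidable (A : forall i, set (X i)) : Prop :=
  open_system A /\ forall i, ~ Q i `<=` A i `|` V i.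

Lemma open_systemU (A B : forall i, set (X i)) :
  open_system A -> open_system B -> open_system (fun i => A i `|` B i).
Proof.
move=> [Aop Ap] [Bop Bp]; split=> [i|i j ij y]; first exact: openU.
by move=> [Ay|By]; [left|right]; [apply: (Ap i j ij)|apply: (Bp i j ij)].
Qed.

Lemma maximal_avoidable : (forall i, ~ Q i `<=` V i) ->
  exists2 A, avoidable A /\ (forall i, V i `<=` A i) &
    forall B, avoidable B -> (forall i, A i `<=` B i) ->
      forall i, B i `<=` A i.
Proof.
move=> nQV.
(* Families are encoded as subsets of the disjoint sum of the [X i], so that Zorn's lemma for unions
   of chains of sets applies. *)
pose slice (A : set {i & X i}) i : set (X i) := [set x | A (existT _ i x)].
have [|A [avA Amax]] := @Zorn_bigcup {i & X i} [set A | avoidable (slice A)].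
  move=> F FP Ftot; split; first split.
  - move=> i; rewrite (_ : slice _ i = \bigcup_(A in F) slice A i) //.
    by apply: bigcup_open => A /FP[[Aop _] _].
  - move=> i j ij x [A FA Ax]; exists A => //.
    by have [[_ Ap] _] := FP _ FA; apply: (Ap i j ij).
  move=> i QA; have [F0|/set0P[A0 FA0]] := eqVneq F set0.
    apply: (nQV i) => x /QA [[A]|//].
    by rewrite F0.
  (* Compactness of [Q i] reduces the cover to a single member [A] of the chain, which contradicts
     the avoidability of [A]. *)
  have [|||_ [A FA <-]] := compact_directed_cover
    (D := [set slice A i `|` V i | A in F]) (Qcs i).1; last first.
  - by have [_] := FP _ FA; exact.
  - move=> x /QA [[A FA Ax]|Vx].
      by exists (slice A i `|` V i); [exists A|left].
    by exists (slice A0 i `|` V i); [exists A0|right].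
  - split; first by exists (slice A0 i `|` V i); exists A0.
    move=> _ _ [A FA <-] [B FB <-].
    have [AB|BA] := Ftot _ _ FA FB.
      exists (slice B i `|` V i); split=> //; first by exists B.
      by apply: setSU => x; exact: AB.
    exists (slice A i `|` V i); split=> //; first by exists A.
    by apply: setSU => x; exact: BA.
  - move=> _ [A FA <-]; have [[Aop _] _] := FP _ FA.
    by apply: openU; [|case: Vsys].
have max B : avoidable B -> (forall i, slice A i `<=` B i) ->
    forall i, B i `<=` slice A i.
  move=> avB AB i x Bx; apply: contrapT => nAx.
  apply: (Amax [set u | B (projT1 u) (projT2 u)]) => //.
  by split=> [[j y]|/(_ (existT _ i x) Bx)//]; exact: AB.
exists (slice A) => //; split=> // i.
(* Adjoining [V] to the maximal family keeps it avoidable, so [V] was already contained in it. *)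
apply: (subset_trans (@subsetUr _ (slice A i) _)).
apply: (max (fun i => slice A i `|` V i)); last by move=> j; exact: subsetUl.
split; first by apply: open_systemU => //; case: avA.
by move=> j; rewrite -setUA setUid; case: avA.
Qed.

(* Steenrod's theorem: the limit of nonempty compact sober spaces is nonempty.
   The complements of a maximal avoidable family are irreducible closed sets,
   and their generic points form the required thread. *)
Lemma exists_thread : (forall i, ~ Q i `<=` V i) ->
  exists2 x, thread x & forall i, Q i (x i) /\ ~ V i (x i).
Proof.
move=> /maximal_avoidable[A [[[Aop Ap] nQAV] VA] Amax].
have nQA i : ~ Q i `<=` A i by move=> QA; apply: (nQAV i) => x /QA; left.
have avoid B : open_system B -> (forall i, A i `<=` B i) ->
    (forall i, ~ Q i `<=` B i) -> forall i, B i `<=` A i.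
  move=> Bsys AB nQB; apply: Amax => //; split=> // i QBV.
  by apply: (nQB i) => x /QBV[//|/VA /AB].
(* Enlarge [A] by the preimages of the complement of [C] at all indices above [i]. If this system
   [B] covered no [Q j], maximality would put the complement of [C] inside [A i]. *)
have split_closed i (C : set (X i)) : closed C -> ~ (~` A i `<=` C) ->
    exists2 j, (i <= j)%O & Q j `<=` A j `|`
      [set y | exists ij : (i <= j)%O, ~ C (p ij y)].
  move=> Ccl nAC; apply: contrapT => noj; apply: nAC => x nAx.
  apply: contrapT => nCx; apply: nAx.
  pose B j := A j `|` [set y : X j | exists ij : (i <= j)%O, ~ C (p ij y)].
  have Bsys : open_system B.
    apply: open_systemU; split=> //.
      move=> j; rewrite (_ : [set y | _] =
        \bigcup_(ij : (i <= j)%O) (p ij @^-1` ~` C)); last first.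
        by apply/seteqP; split=> y [ij]; [exists ij|move=> _; exists ij].
      by apply: bigcup_open => ij _; apply/psys_open/closed_openC.
    move=> j k jk y [ij nCy]; exists (le_trans ij jk).
    by rewrite -(psys_comp ij jk).
  apply: (avoid B) => //; first by move=> j; exact: subsetUl.
    move=> j QB; have [k ik jk] := psys_ub i j.
    apply: noj; exists k => // y /(Qp jk) /QB; exact: Bsys.2.
  by right; exists (lexx i); rewrite psys_id.
(* At a common upper bound [l] of the two indices obtained for [C] and [D], a point of [Q l] outside
   [A l] projects to a point outside [A i], [C] and [D]. *)
have irr i : irreducible (~` A i).
  split.
    by move: (nQA i) => /existsNP[x] /not_implyP[_ nAx]; exists x.
  move=> C D Ccl Dcl CD; apply: contrapT => /not_orP[].
  move=> /(split_closed _ _ Ccl)[j ij Qj] /(split_closed _ _ Dcl)[k ik Qk].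
  have [l jl kl] := psys_ub j k; have il := le_trans ij jl.
  have [y /not_implyP[Qy nAy]] : exists y, ~ (Q l y -> A l y).
    by apply/existsNP; exact: nQA.
  have [/(Ap _ _ jl) //|[ij' nC]] := Qj _ (Qp jl Qy).
  have [/(Ap _ _ kl) //|[ik' nD]] := Qk _ (Qp kl Qy).
  have /CD : ~ A i (p il y) by move=> /(Ap _ _ il).
  by move: nC nD; rewrite !(psys_comp _ _ il) => nC nD [].
have [x xE] : {x : forall i, X i & forall i, ~` A i = closure [set x i]}.
  have gen i : {x | ~` A i = closure [set x]}.
    by apply/cid; apply: (sober i).2; [exact: open_closedC|exact: irr].
  by exists (fun i => projT1 (gen i)) => i; case: (gen i).
have nAx i : ~ A i (x i).
  by have : closure [set x i] (x i) by [exact: subset_closure]; rewrite -xE.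
exists x; last first.
  move=> i; split; last by move=> /VA; exact: nAx.
  have [y /not_implyP[Qy nAy]] : exists y, ~ (Q i y -> A i y).
    by apply/existsNP; exact: nQA.
  apply: (saturated_specialization (Qcs i).2 Qy).
  by rewrite -xE.
(* By the $T_0$ axiom, a neighbourhood [N] separates the two points. It cannot be one of
   [p ij (x j)] missing [x i], since [p ij (x j)] lies outside [A i], hence in the closure of
   [x i]. *)
move=> i j ij; apply: contrapT => /eqP /(sober i).1[N].
case; rewrite !inE => -[Nn nN].
  have : closure [set x i] (p ij (x j)).
    by rewrite -xE => /(Ap _ _ ij); exact: nAx.
  by move=> /(_ _ Nn)[_ [-> /nN]].
(* Now [N] is a neighbourhood of [x i] missing [p ij (x j)]. The system [B] gathers the open sets
   whose preimage at some later index is inside [A]; maximality gives that [B] is below [A]. *)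
pose B k := \bigcup_(U in [set U : set (X k) | open U /\
  exists l (kl : (k <= l)%O), p kl @^-1` U `<=` A l]) U.
have Bsys : open_system B.
  split=> [k|k l kl y [U [Uop [m [km UA]]] Uy]].
    by apply: bigcup_open => U [].
  exists (p kl @^-1` U) => //; split; first exact: psys_open.
  have [n ln mn] := psys_ub l m; exists n, ln => z.
  rewrite /preimage/= (psys_comp kl ln (le_trans km mn)).
  rewrite -(psys_comp km mn) => /(UA (p mn z)); exact: Ap.
have BA : forall k, B k `<=` A k.
  apply: avoid => // k.
    move=> y Ay; exists (A k) => //; split=> //.
    by exists k, (lexx k) => z; rewrite /preimage/= psys_id.
  move=> QB.
  have [||U [_ [l [kl UA]]] QU] := compact_directed_cover (Qcs k).1 _ _ QB.
  - by move=> U [].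
  - split.
      exists set0; split; first exact: open0.
      by exists k, (lexx k) => z.
    move=> U U' [Uop [l [kl UA]]] [U'op [l' [kl' U'A]]].
    exists (U `|` U'); split; [|exact: subsetUl|exact: subsetUr].
    split; first exact: openU.
    have [m lm l'm] := psys_ub l l'; exists m, (le_trans kl lm) => z [].
      by rewrite /= -(psys_comp kl lm) => /(UA (p lm z)); exact: Ap.
    by rewrite /= -(psys_comp kl' l'm) => /(U'A (p l'm z)); exact: Ap.
  - by apply: (nQA l) => y /(Qp kl) /QU; exact: UA.
(* The preimage of [N°] in [X j] lies in [A j]: otherwise it would meet the closure of [x j], hence
   contain [x j]. So [N°] is part of [B i], and [x i] would be in [A i]. *)
apply: (nAx i); apply: BA; exists N° => //; split; first exact: open_interior.
exists j, ij => y /= Ny; apply: contrapT => nAy.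
have yx : closure [set x j] y by rewrite -xE.
have [|_ [-> /interior_subset /nN//]] := yx (p ij @^-1` N°).
apply: open_nbhs_nbhs; split=> //.
exact/psys_open/open_interior.
Qed.

End OpenSystems.

(** * The topology of a projective limit *)

Section Limits.
Context {d : Order.disp_t} {I : preorderType d} {X : I -> topologicalType}.
Context {p : forall i j : I, (i <= j)%O -> X j -> X i}.
Context {L : topologicalType} {q : forall i : I, L -> X i}.
Hypothesis psys : projective_system p.
Hypothesis lim : projective_limit p q.

Lemma limit_comp i j (ij : (i <= j)%O) y : p ij (q j y) = q i y.
Proof. by have [[_ pq] _] := lim; rewrite -(pq i j ij). Qed.

Lemma limit_open i (U : set (X i)) : open U -> open (q i @^-1` U).
Proof. by have [[qcont _] _] := lim; exact: (continuousP _).1. Qed.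

(** The constant maps from the nonempty space [bool] form a cone; any value of the mediating map is
    the required point. *)
Lemma limit_thread x : thread p x -> exists y, forall i, q i y = x i.
Proof.
move=> xth; have [_ /(_ bool (fun i _ => x i))[]] := lim.
  split=> [i|i j ij]; first exact: cst_continuous.
  by apply/funext => b /=; exact: xth.
by move=> h [[_ qh] _]; exists (h true) => i; exact: (congr1 (@^~ true) (qh i)).
Qed.

(* The identity from the set L with the coarsest topology making all the q i
   continuous factors through L, so the topology of L is the coarsest one. *)
Lemma limit_base (U : set L) y : open U -> U y ->
  exists i (V : set (X i)), [/\ open V, V (q i y) & q i @^-1` V `<=` U].
Proof.
pose op : set (set L) := [set U | forall y, U y ->
  exists i (V : set (X i)), [/\ open V, V (q i y) & q i @^-1` V `<=` U]].
have [[[i0 _] _] _ _ _] := psys.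
have opT : op setT.
  by move=> z _; exists i0, setT; split=> //; exact: openT.
have opI : setI_closed op.
  move=> A B Aop Bop z [/Aop[i [V [Vop Vz VA]]] /Bop[j [W [Wop Wz WB]]]].
  have [k ik jk] := psys_ub psys i j.
  exists k, (p ik @^-1` V `&` p jk @^-1` W); split.
  - by apply: openI; exact: psys_open.
  - by split; rewrite /preimage/= limit_comp.
  - by move=> w [] /=; rewrite !limit_comp => /VA ? /WB.
have op_bigU (J : Type) (f : J -> set L) :
    (forall t, op (f t)) -> op (\bigcup_t f t).
  move=> fop z [t _ /fop[i [V [Vop Vz Vf]]]]; exists i, V; split=> //.
  by move=> w /Vf; exists t.
pose M : topologicalType := HB.pack (L : Type) (Choice.class L)
  (isOpenTopological.Build L opT opI op_bigU).
have qM i : continuous (q i : M -> X i).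
  apply/continuousP => V Vop; rewrite -[open _]/(op (q i @^-1` V)) => z Vz.
  by exists i, V; split.
have [[_ pq] /(_ M q)[//|h [[hcont qh] _]]] := lim.
(* The identity from [M] to [L] is not yet known to be continuous, so uniqueness is applied on
   [bool] instead: the constants [z] and [h z] both mediate the same constant cone. *)
have hid z : h z = z.
  have [_ /(_ bool (fun i _ => q i z))[]] := lim.
    split=> [i|i j ij]; first exact: cst_continuous.
    by apply/funext => b /=; exact: limit_comp.
  move=> g [_ guniq].
  have gz : g = fun=> z by apply: guniq; split=> //; exact: cst_continuous.
  have ghz : g = fun=> h z.
    apply: guniq; split; first exact: cst_continuous.
    by move=> i; apply/funext => b; exact: (congr1 (@^~ z) (qh i)).
  by rewrite -[LHS](congr1 (@^~ true) ghz) gz.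
move=> Uop Uy; have : open (h @^-1` U : set M) by exact: (continuousP _).1.
move=> /(_ y)[|i [V [Vop Vy VU]]]; first by rewrite /preimage/= hid.
by exists i, V; split=> // z /VU; rewrite /preimage/= hid.
Qed.

(** On open sets, [trace] at [i] is right adjoint to the preimage map of [q i]. *)
Definition trace (U : set L) i : set (X i) :=
  \bigcup_(V in [set V : set (X i) | open V /\ q i @^-1` V `<=` U]) V.
Arguments trace : clear implicits.

Lemma trace_open_system U : open_system p (trace U).
Proof.
split=> [i|i j ij x [V [Vop VU] Vx]]; first by apply: bigcup_open => V [].
exists (p ij @^-1` V) => //; split; first exact: psys_open.
by move=> y /=; rewrite limit_comp => /VU.
Qed.

Lemma trace_max U i (V : set (X i)) :
  open V -> q i @^-1` V `<=` U -> V `<=` trace U i.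
Proof. by move=> Vop VU x Vx; exists V. Qed.

Lemma traceS U W i : U `<=` W -> trace U i `<=` trace W i.
Proof.
by move=> UW x [V [Vop VU] Vx]; exists V => //; split=> // y /VU /UW.
Qed.

Lemma bigcup_trace U : open U -> \bigcup_i q i @^-1` trace U i = U.
Proof.
move=> Uop; apply/seteqP; split=> [y [i _ [V [_ VU] /VU//]]|y Uy].
by have [i [V [Vop Vy VU]]] := limit_base Uop Uy; exists i => //; exists V.
Qed.

End Limits.

Arguments trace {d I X L} q U i _.

(** * Valuations *)

Section Valuations.
Context {R : realType}.

(** Directedness bounds every mixed sum [a s + b t] by a diagonal one. When the diagonal supremum is
    finite, all terms are finite and can be subtracted in turn. *)
Lemma ereal_supD (T : Type) (le : T -> T -> Prop) (a b : T -> \bar R) :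
  directed le [set: T] -> (forall t, 0 <= a t) -> (forall t, 0 <= b t) ->
  (forall s t, le s t -> a s <= a t) -> (forall s t, le s t -> b s <= b t) ->
  ereal_sup (range (fun t => a t + b t)) =
  ereal_sup (range a) + ereal_sup (range b).
Proof.
move=> [[t0 _] Tdir] a0 b0 amono bmono; apply/eqP; rewrite eq_le.
apply/andP; split.
  apply: ge_ereal_sup => _ [t _ <-].
  by apply: leeD; apply: ereal_sup_ubound; exists t.
set M := ereal_sup (range (fun t => a t + b t)).
have leM s t : a s + b t <= M.
  have [//|//|u [_ su tu]] := Tdir s t.
  apply: (@le_trans _ _ (a u + b u)); first by apply: leeD; auto.
  by apply: ereal_sup_ubound; exists u.
have ge0 (f : T -> \bar R) : (forall t, 0 <= f t) -> 0 <= ereal_sup (range f).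
  by move=> f0; apply: (le_trans (f0 t0)); apply: ereal_sup_ubound; exists t0.
have aM : ereal_sup (range a) <= M.
  by apply: ge_ereal_sup => _ [t _ <-]; apply: le_trans (leM t t); exact: leeDl.
have bM : ereal_sup (range b) <= M.
  by apply: ge_ereal_sup => _ [t _ <-]; apply: le_trans (leM t t); exact: leeDr.
have [->|Mfin] := eqVneq M +oo; first exact: leey.
have Mlt : M < +oo by rewrite ltey.
have bfin : ereal_sup (range b) \is a fin_num.
  by rewrite ge0_fin_numE; [exact: le_lt_trans bM Mlt|exact: ge0].
rewrite -leeBrDr//; apply: ge_ereal_sup => _ [s _ <-].
have afin : a s \is a fin_num.
  rewrite ge0_fin_numE//; apply: le_lt_trans Mlt.
  by apply: le_trans (leM s s); exact: leeDl.
rewrite leeBrDr// -leeBrDl//; apply: ge_ereal_sup => _ [t _ <-].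
by rewrite leeBrDl.
Qed.

(** Continuity turns the directed union of interiors given by local compactness into a supremum, so
    some interior already exceeds [r]. *)
Lemma compact_inner_regular (X : topologicalType) (nu : set X -> \bar R) U r :
  locally_compact_space X -> continuous_valuation nu -> open U -> r < nu U ->
  exists Q : set X, [/\ compact_saturated Q, Q `<=` U & r < nu Q°].
Proof.
move=> lc [_ nucont] Uop; have [intdir UE] := lc U Uop.
rewrite UE nucont//; last by move=> _ [Q _ <-]; exact: open_interior.
by move=> /ereal_sup_gt[_ [_ [Q [Qcs QU] <-] <-] rQ]; exists Q; rewrite -UE.
Qed.

Lemma compact_tower (X : nat -> topologicalType)
    (p : forall n m : nat, (n <= m)%O -> X m -> X n)
    (nu : forall n, set (X n) -> \bar R) (W : set (X 0%N)) (r : \bar R) :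
  valued_projective_system p nu -> (forall n, locally_compact_space (X n)) ->
  open W -> r < nu 0%N W ->
  exists Q : forall n, set (X n),
    [/\ forall n, compact_saturated (Q n), Q 0%N `<=` W,
        forall (n m : nat) (nm : (n <= m)%O), Q m `<=` p n m nm @^-1` Q n &
        forall n, r < nu n (Q n)°].
Proof.
move=> [psys nucv pnu] lc Wop rW.
(* [T n] carries the invariant of the recursion: the strict bound on the interior passes to its
   preimage at level [n.+1], where inner regularity applies again. *)
pose T n := {Q : set (X n) | compact_saturated Q /\ r < nu n Q°}.
have [Q0 Q0W] : {Q : T 0%N | projT1 Q `<=` W}.
  have [Q [Qcs QW rQ]] :=
    cid (compact_inner_regular (lc 0%N) (nucv 0%N) Wop rW).
  by exists (exist _ Q (conj Qcs rQ)).
have step n (Q : T n) :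
    {Q' : T n.+1 | projT1 Q' `<=` p n n.+1 (leqnSn n) @^-1` projT1 Q}.
  case: Q => Q [Qcs rQ].
  have Uop : open (p n n.+1 (leqnSn n) @^-1` Q°).
    by apply: psys_open psys _ _ _ _ _; exact: open_interior.
  have rU : r < nu n.+1 (p n n.+1 (leqnSn n) @^-1` Q°).
    by rewrite -/(image_valuation _ _ _) pnu//; exact: open_interior.
  have [Q' [Q'cs Q'U rQ']] :=
    cid (compact_inner_regular (lc _) (nucv _) Uop rU).
  exists (exist _ Q' (conj Q'cs rQ')) => /= y /Q'U; exact: interior_subset.
pose Q := nat_rect T Q0 (fun n Qn => projT1 (step n Qn)).
exists (fun n => projT1 (Q n)); split=> //.
- by move=> n; case: (Q n) => ? [].
- move=> n; elim=> [|m IHm] nm.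
    have n0 : n = 0%N by apply/eqP; rewrite -leqn0.
    by rewrite n0 in nm * => y; rewrite /preimage/= (psys_id psys).
  have [n_eq|n_lt] := eqVneq n m.+1.
    by rewrite n_eq in nm * => y; rewrite /preimage/= (psys_id psys).
  have nm' : (n <= m)%O by rewrite leEnat -ltnS ltn_neqAle n_lt.
  move=> y /(projT2 (step m (Q m))) /(IHm nm').
  by rewrite /preimage/= (psys_comp psys nm' _ nm).
- by move=> n; case: (Q n) => ? [].
Qed.

End Valuations.

(** * Cofinal sequences *)

Lemma cofinal_chain (d : Order.disp_t) (I : preorderType d) (k : I) :
  directed (fun i j : I => (i <= j)%O) [set: I] -> has_countable_cofinal I ->
  exists c : nat -> I, [/\ (k <= c 0%N)%O,
    forall n m, (n <= m)%O -> (c n <= c m)%O &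
    forall i, exists n, (i <= c n)%O].
Proof.
move=> [_ Idir] [C /countable_injP[f finj] Ccof].
have [e eC] : exists e : nat -> I, forall i, C i -> exists n, e n = i.
  (* A partial inverse of the injection [f] enumerates [C]; [k] is the default value at integers
     outside the image of [C]. *)
  have /choice[e eP] : forall n, exists i, forall j, C j -> f j = n -> i = j.
    move=> n; have [[j Cj fj]|nj] := pselect (exists2 j, C j & f j = n).
      by exists j => l Cl fl; apply: finj; rewrite ?inE// fj.
    by exists k => j Cj fj; case: nj; exists j.
  by exists e => i Ci; exists (f i); exact: eP.
have ub (i j : I) : {l | (i <= l)%O & (j <= l)%O}.
  by apply/cid2; have [//|//|l [_ il jl]] := Idir i j; exists l.
(* Each new term bounds the previous one and the next enumerated element. *)
pose c := nat_rect (fun=> I) k (fun n i => s2val (ub i (e n))).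
have cS n : (c n <= c n.+1)%O /\ (e n <= c n.+1)%O.
  by rewrite /=; case: (ub (c n) (e n)).
exists c; split; first exact: lexx.
  move=> n m /subnKC <-; elim: (m - n)%N => [|l IHl]; first by rewrite addn0.
  by rewrite addnS; apply: le_trans IHl _; exact: (cS _).1.
move=> i; have [j Cj ij] := Ccof i; have [n en] := eC j Cj.
by exists n.+1; apply: le_trans ij _; rewrite -en; exact: (cS n).2.
Qed.

(** * The valuation on the limit *)

Section LimitValuation.
Context {R : realType} {d : Order.disp_t} {I : preorderType d}.
Context {X : I -> topologicalType} {nu : forall i : I, set (X i) -> \bar R}.
Context {p : forall i j : I, (i <= j)%O -> X j -> X i}.
Context {L : topologicalType} {q : forall i : I, L -> X i}.
Arguments nu : clear implicits.
Hypothesis vsys : valued_projective_system p nu.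
Hypothesis lim : projective_limit p q.
Hypothesis cof : has_countable_cofinal I.
Hypothesis lc : forall i : I, locally_compact_space (X i).
Hypothesis sober : forall i : I, sober_space (X i).

Let psys : projective_system p. Proof. by case: vsys. Qed.

Let Idir : directed (fun i j : I => (i <= j)%O) [set: I].
Proof. by case: psys. Qed.

Let nuS i (U V : set (X i)) : open U -> open V -> U `<=` V -> nu i U <= nu i V.
Proof.
have [_ nucv _] := vsys; have [[_ _ nuS _] _] := nucv i; exact: nuS.
Qed.

Let nu_ge0 i (U : set (X i)) : open U -> 0 <= nu i U.
Proof.
have [_ nucv _] := vsys; have [[nu0 _ _ _] _] := nucv i; exact: nu0.
Qed.

Lemma open_system_nu (V : forall i, set (X i)) i j :
  open_system p V -> (i <= j)%O -> nu i (V i) <= nu j (V j).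
Proof.
move=> [Vop Vp] ij; have [_ _ pnu] := vsys.
rewrite -(pnu _ _ ij)//; apply: nuS => //; exact: psys_open.
Qed.

(** The coordinate at [i] is the image of any [x n] with [i] below [c n]; compatibility along the
    chain makes it independent of [n]. *)
Lemma thread_of_chain (c : nat -> I)
    (cmono : forall n m, (n <= m)%O -> (c n <= c m)%O) (x : forall n, X (c n)) :
  (forall i, exists n, (i <= c n)%O) ->
  (forall n m (nm : (n <= m)%O), p (cmono n m nm) (x m) = x n) ->
  exists y, forall i n (ic : (i <= c n)%O), q i y = p ic (x n).
Proof.
move=> ccof xth; have N i : {n | (i <= c n)%O} by exact: cid.
have xE i n m (ic : (i <= c n)%O) (ic' : (i <= c m)%O) :
    p ic (x n) = p ic' (x m).
  wlog nm : n m ic ic' / (n <= m)%O.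
    move=> H; have [nm|/ltW mn] := leP n m; first exact: H.
    by apply/esym; exact: H.
  by rewrite -(xth n m nm) (psys_comp psys).
have [|y yE] := limit_thread lim
    (x := fun i => p (projT2 (N i)) (x (projT1 (N i)))) _.
  by move=> i j ij; rewrite (psys_comp psys ij _ (le_trans ij (projT2 (N j)))).
by exists y => i n ic; rewrite yE.
Qed.

(* Every open system covering the limit of the compact sets [Q n] covers some
   [Q n] already: this is where sobriety enters. *)
Lemma compact_approximation k (W : set (X k)) r : open W -> r < nu k W ->
  exists (c : nat -> I) (Q : forall n, set (X (c n))),
    [/\ forall n, compact_saturated (Q n),
        \bigcap_n q (c n) @^-1` Q n `<=` q k @^-1` W,
        forall n, r < nu (c n) (Q n)° &
        forall V, open_system p V ->
          \bigcap_n q (c n) @^-1` Q n `<=` \bigcup_i q i @^-1` V i ->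
          exists n, Q n `<=` V (c n)].
Proof.
move=> Wop rW; have [[_ pcont pid pcomp] nucv pnu] := vsys.
have [c [kc cmono ccof]] := cofinal_chain k Idir cof.
have csys : valued_projective_system
    (fun (n m : nat) (nm : (n <= m)%O) => p (cmono n m nm)) (fun n => nu (c n)).
  split=> [|n|n m nm]; [|exact: nucv|exact: pnu].
  split=> [|n m nm|n nn|n m l nm ml nl];
    [|exact: pcont|exact: pid|exact: pcomp].
  split=> [|n m _ _]; first by exists 0%N.
  by exists (maxn n m); split; rewrite // leEnat ?leq_maxl ?leq_maxr.
have [csys' _ _] := csys.
have [||Q [Qcs QW Qp rQ]] := compact_tower csys (fun n => @lc (c n))
    (W := p kc @^-1` W) (r := r) _ _.
- exact: psys_open.
- by rewrite -/(image_valuation _ _ _) pnu.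
exists c, Q; split=> //.
  by move=> y /(_ 0%N Logic.I) /QW; rewrite /preimage/= (limit_comp lim).
move=> V [Vop Vp] QV; apply: contrapT => /forallNP noV.
have [|x xth Qx] := exists_thread csys' (fun n => @sober (c n)) Qcs Qp _ noV.
  by split=> [n|n m nm]; [exact: Vop|exact: Vp].
have [y yE] := thread_of_chain ccof xth.
have [n _|i _ /= Vy] := QV y.
  by rewrite /preimage/= (yE _ _ (lexx _)) (psys_id psys); exact: (Qx n).1.
(* If [y] met [V i], then [x n] would lie in [V (c n)] for any [n] with [i] below [c n]. *)
have [n ic] := ccof i; apply: (Qx n).2; apply: (Vp i (c n) ic).
by rewrite /preimage/= -yE.
Qed.

Lemma open_system_cover k (W : set (X k)) (V : forall i, set (X i)) :
  open W -> open_system p V -> q k @^-1` W `<=` \bigcup_i q i @^-1` V i ->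
  nu k W <= ereal_sup (range (fun i => nu i (V i))).
Proof.
move=> Wop Vsys WV; rewrite leNgt; apply/negP.
move=> /(compact_approximation Wop)[c [Q [Qcs QW rQ QV]]].
have [n Qn] := QV V Vsys (subset_trans QW WV).
have := rQ n; rewrite ltNge => /negP; apply.
apply: (@le_trans _ _ (nu (c n) (V (c n)))).
  apply: nuS; [exact: open_interior|by case: Vsys|].
  by apply: subset_trans Qn; exact: interior_subset.
by apply: ereal_sup_ubound; exists (c n).
Qed.

Definition limit_valuation (U : set L) : \bar R :=
  ereal_sup (range (fun i => nu i (trace q U i))).

(** Any open system presenting an open set computes its value. This matters because unions of traces
    may be smaller than traces of unions. *)
Lemma limit_valuationE (V : forall i, set (X i)) : open_system p V ->
  limit_valuation (\bigcup_i q i @^-1` V i) =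
  ereal_sup (range (fun i => nu i (V i))).
Proof.
move=> Vsys; have tsys := trace_open_system psys lim.
apply/eqP; rewrite eq_le; apply/andP; split.
  apply: ge_ereal_sup => _ [i _ <-]; apply: open_system_cover => //.
    exact: (tsys _).1.
  by move=> y [U [_ UV] /UV].
apply: ge_ereal_sup => _ [i _ <-].
apply: (@le_trans _ _ (nu i (trace q (\bigcup_i q i @^-1` V i) i))).
  apply: nuS; [exact: Vsys.1|exact: (tsys _).1|].
  by apply: trace_max; [exact: Vsys.1|move=> y Vy; exists i].
by apply: ereal_sup_ubound; exists i.
Qed.

Lemma limit_valuationS (U W : set L) :
  U `<=` W -> limit_valuation U <= limit_valuation W.
Proof.
move=> UW; have tsys := trace_open_system psys lim.
apply: ge_ereal_sup => _ [i _ <-].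
apply: (@le_trans _ _ (nu i (trace q W i))).
  by apply: nuS; [exact: (tsys _).1|exact: (tsys _).1|exact: traceS].
by apply: ereal_sup_ubound; exists i.
Qed.

Lemma limit_valuation_image i :
  eq_on_opens (nu i) (image_valuation (q i) limit_valuation).
Proof.
move=> U Uop; rewrite /image_valuation; apply/eqP; rewrite eq_le.
apply/andP; split.
  apply: (@le_trans _ _ (nu i (trace q (q i @^-1` U) i))).
    by apply: nuS; [|exact: (trace_open_system psys lim _).1|exact: trace_max].
  by apply: ereal_sup_ubound; exists i.
(* This system presents the preimage of [U]: it is the preimage of [U] above [i] and empty at all
   other indices. *)
pose V j := [set y : X j | exists ij : (i <= j)%O, U (p ij y)].
have VE j (ij : (i <= j)%O) : V j = p ij @^-1` U.
  apply/seteqP; split=> [y [ij' Uy]|y Uy]; last by exists ij.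
  by rewrite /preimage/= (bool_irrelevance ij ij').
have Vsys : open_system p V.
  split=> [j|j k jk y [ij Uy]].
    have [ij|nij] := boolP (i <= j)%O.
      by rewrite (VE j ij); exact: psys_open.
    rewrite (_ : V j = set0); first exact: open0.
    by apply/seteqP; split=> y // [ij]; rewrite ij in nij.
  by exists (le_trans ij jk); rewrite -(psys_comp psys ij jk).
rewrite (_ : q i @^-1` U = \bigcup_j q j @^-1` V j); last first.
  apply/seteqP; split=> [y Uy|y [j _ [ij]]]; last by rewrite (limit_comp lim).
  by exists i => //; exists (lexx i); rewrite (limit_comp lim).
rewrite limit_valuationE//; apply: ge_ereal_sup => _ [j _ <-].
have [k ik jk] := psys_ub psys i j.
apply: (le_trans (open_system_nu Vsys jk)).
by have [_ _ pnu] := vsys; rewrite (VE k ik) -(pnu _ _ ik).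
Qed.

Lemma limit_valuation_continuous : continuous_valuation limit_valuation.
Proof.
have [_ nucv pnu] := vsys; have tsys := trace_open_system psys lim.
have [[i0 _] _] := Idir.
split; first split.
- move=> U Uop; apply: (@le_trans _ _ (nu i0 (trace q U i0))).
    exact/nu_ge0/(tsys _).1.
  by apply: ereal_sup_ubound; exists i0.
(* The empty set is the preimage of the empty set of [X i0]. *)
- rewrite -[limit_valuation _]/(image_valuation (q i0) limit_valuation set0).
  rewrite -limit_valuation_image; last exact: open0.
  by have [[_ + _ _] _] := nucv i0.
- by move=> U W _ _; exact: limit_valuationS.
(* Modularity holds index by index for the traces, and directed suprema commute with sums. *)
- move=> U W Uop Wop.
  have sysU := open_systemU (tsys U) (tsys W).
  have sysI : open_system p (fun i => trace q U i `&` trace q W i).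
    split=> [i|i j ij y [Uy Wy]]; first by apply: openI; exact: (tsys _).1.
    by split; [apply: (tsys U).2 Uy|apply: (tsys W).2 Wy].
  have UWE : U `|` W = \bigcup_i q i @^-1` (trace q U i `|` trace q W i).
    rewrite -{1}(bigcup_trace psys lim Uop) -{1}(bigcup_trace psys lim Wop).
    by rewrite -bigcupU.
  have UIE : U `&` W = \bigcup_i q i @^-1` (trace q U i `&` trace q W i).
    rewrite -{1}(bigcup_trace psys lim Uop) -{1}(bigcup_trace psys lim Wop).
    apply/seteqP; split=> [y [[i _ Uy] [j _ Wy]]|y [i _ [Uy Wy]]]; last first.
      by split; exists i.
    have [k ik jk] := psys_ub psys i j; exists k => //; split.
      by apply: ((tsys U).2 i k ik); rewrite /preimage/= (limit_comp lim).
    by apply: ((tsys W).2 j k jk); rewrite /preimage/= (limit_comp lim).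
  rewrite UWE UIE !limit_valuationE//.
  rewrite -(ereal_supD Idir); last 4 first.
  + by move=> i; exact/nu_ge0/sysU.1.
  + by move=> i; exact/nu_ge0/sysI.1.
  + by move=> i j; exact: (open_system_nu sysU).
  + by move=> i j; exact: (open_system_nu sysI).
  rewrite -(ereal_supD Idir); last 4 first.
  + by move=> i; exact/nu_ge0/(tsys U).1.
  + by move=> i; exact/nu_ge0/(tsys W).1.
  + by move=> i j; exact: (open_system_nu (tsys U)).
  + by move=> i j; exact: (open_system_nu (tsys W)).
  congr ereal_sup; apply: eq_imagel => i _.
  have [[_ _ _ numod] _] := nucv i.
  exact: (numod _ _ ((tsys U).1 i) ((tsys W).1 i)).
(* The unions over [D] of the traces present the union of [D]; continuity of each [nu i] then
   reduces the claim to exchanging two suprema. *)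
- move=> D Dop [[U0 DU0] Ddir].
  pose V i := \bigcup_(W in [set trace q U i | U in D]) W.
  have Vsys : open_system p V.
    split=> [i|i j ij y [_ [U DU <-] Uy]].
      by apply: bigcup_open => _ [U DU <-]; exact: (tsys _).1.
    exists (trace q U j); first by exists U.
    exact: ((tsys U).2 i j ij).
  have VE : \bigcup_(U in D) U = \bigcup_i q i @^-1` V i.
    apply/seteqP; split=> [y [U DU]|y [i _ [_ [U DU <-]]]].
      rewrite -{1}(bigcup_trace psys lim (Dop _ DU)) => -[i _ Uy].
      by exists i => //; exists (trace q U i) => //; exists U.
    move=> Uy; exists U => //.
    by rewrite -(bigcup_trace psys lim (Dop _ DU)); exists i.
  apply/eqP; rewrite eq_le; apply/andP; split; last first.
    apply: ge_ereal_sup => _ [U DU <-]; apply: limit_valuationS => y Uy.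
    by exists U.
  rewrite VE limit_valuationE//; apply: ge_ereal_sup => _ [i _ <-].
  have [_ nucont] := nucv i; rewrite /V nucont; last 2 first.
  + by move=> _ [U DU <-]; exact: (tsys _).1.
  + split; first by exists (trace q U0 i), U0.
    move=> _ _ [U DU <-] [W DW <-]; have [Z [DZ UZ WZ]] := Ddir U W DU DW.
    by exists (trace q Z i); split; [exists Z|exact: traceS|exact: traceS].
  apply: ge_ereal_sup => _ [_ [U DU <-] <-].
  apply: (@le_trans _ _ (limit_valuation U)).
    by apply: ereal_sup_ubound; exists i.
  by apply: ereal_sup_ubound; exists U.
Qed.

Lemma limit_valuation_unique nu' : continuous_valuation nu' ->
  (forall i, eq_on_opens (nu i) (image_valuation (q i) nu')) ->
  eq_on_opens limit_valuation nu'.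
Proof.
move=> [_ nu'cont] nu'E U Uop; have tsys := trace_open_system psys lim.
have [[i0 _] _] := Idir.
have UE : U = \bigcup_(W in range (fun i => q i @^-1` trace q U i)) W.
  by rewrite bigcup_image -[LHS](bigcup_trace psys lim Uop).
rewrite [in RHS]UE nu'cont; last 2 first.
- by move=> _ [i _ <-]; apply: (limit_open lim); exact: (tsys _).1.
- split; first by exists (q i0 @^-1` trace q U i0), i0.
  move=> _ _ [i _ <-] [j _ <-]; have [k ik jk] := psys_ub psys i j.
  exists (q k @^-1` trace q U k); split; first by exists k.
    move=> y Uy; apply: ((tsys U).2 i k ik).
    by rewrite /preimage/= (limit_comp lim).
  move=> y Uy; apply: ((tsys U).2 j k jk).
  by rewrite /preimage/= (limit_comp lim).
rewrite image_comp; congr ereal_sup; apply: eq_imagel => i _ /=.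
by rewrite (nu'E i) //; exact: (tsys _).1.
Qed.

Lemma limit_valuation_tight : tight limit_valuation.
Proof.
have tsys := trace_open_system psys lim.
have lvcont := limit_valuation_continuous.
move=> U Uop r r0 [->|].
  (* For [r = 0] the empty compact set suffices. *)
  exists set0; split=> //; last first.
    apply: le_ereal_inf_tmp => _ [W [Wop _] <-].
    by have [[+ _ _ _] _] := lvcont; exact.
  split; first exact: compact0.
  by exists [set set0]; [move=> _ ->; exact: open0|rewrite bigcap_set1].
move=> /ereal_sup_gt[_ [k _ <-] rk].
have [c [Q [Qcs QW rQ QV]]] := compact_approximation ((tsys U).1 k) rk.
exists (\bigcap_n q (c n) @^-1` Q n); split; first split.
(* The traces of the members of [D] unite to an open system, which covers some [Q n]; compactness of
   that [Q n] then selects one member of [D]. *)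
- apply: directed_cover_compact => D Dop [[U0 DU0] Ddir] QD.
  pose V i := \bigcup_(U in D) trace q U i.
  have [||n Qn] := QV V.
  + split=> [i|i j ij y [W DW Wy]].
      by apply: bigcup_open => W _; exact: (tsys _).1.
    by exists W => //; exact: ((tsys W).2 i j ij).
  + move=> y /QD[W DW]; rewrite -{1}(bigcup_trace psys lim (Dop _ DW)).
    by move=> [i _ Wy]; exists i => //; exists W.
  have [|||_ [W DW <-] QnW] := compact_directed_cover
      (D := [set trace q W (c n) | W in D]) (Qcs n).1.
  + by move=> _ [W _ <-]; exact: (tsys _).1.
  + split; first by exists (trace q U0 (c n)), U0.
    move=> _ _ [W DW <-] [W' DW' <-]; have [Z [DZ WZ WZ']] := Ddir W W' DW DW'.
    by exists (trace q Z (c n)); split; [exists Z|exact: traceS|exact: traceS].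
  + by rewrite bigcup_image.
  exists W => // y /(_ n Logic.I) /QnW Wy.
  by rewrite -(bigcup_trace psys lim (Dop _ DW)); exists (c n).
- apply: saturated_bigcap => n; apply: saturated_preimage (Qcs n).2.
  by have [[qcont _] _] := lim.
- apply: subset_trans QW _ => y Uy.
  by rewrite -(bigcup_trace psys lim Uop); exists k.
(* The traces of an open [W] around the intersection cover some [Q n], so the value of [W] is at
   least that of the interior of [Q n]. *)
apply: le_ereal_inf_tmp => _ [W [Wop QWs] <-].
have [|n Qn] := QV _ (tsys W); first by rewrite (bigcup_trace psys lim Wop).
apply/ltW/(lt_le_trans (rQ n)).
apply: (@le_trans _ _ (nu (c n) (trace q W (c n)))).
  apply: nuS; [exact: open_interior|exact: (tsys _).1|].
  by apply: subset_trans Qn; exact: interior_subset.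
by apply: ereal_sup_ubound; exists (c n).
Qed.

End LimitValuation.

Theorem theorem8p1 (R : realType) (d : Order.disp_t) (I : preorderType d)
    (Xs : I -> topologicalType) (nus : forall i : I, set (Xs i) -> \bar R)
    (pij : forall i j : I, (i <= j)%O -> Xs j -> Xs i)
    (X : topologicalType) (p : forall i : I, X -> Xs i) :
  valued_projective_system pij nus ->
  projective_limit pij p ->
  has_countable_cofinal I ->
  (forall i : I, locally_compact_space (Xs i)) ->
  (forall i : I, sober_space (Xs i)) ->
  exists nu : set X -> \bar R,
    [/\ continuous_valuation nu,
        forall i : I, eq_on_opens (nus i) (image_valuation (p i) nu),
        forall nu' : set X -> \bar R,
          continuous_valuation nu' ->
          (forall i : I, eq_on_opens (nus i) (image_valuation (p i) nu')) ->
          eq_on_opens nu nu' &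
        tight nu].
Proof.
move=> vsys lim cof lc sober.
exists (limit_valuation (nu := nus) (q := p)); split.
- exact: limit_valuation_continuous vsys lim cof lc sober.
- exact: limit_valuation_image vsys lim cof lc sober.
- exact: (limit_valuation_unique vsys lim).
- exact: limit_valuation_tight vsys lim cof lc sober.
Qed.
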